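(* Let $\gamma=(t,r,\theta,\phi):I\to\mathcal M$ be a time-like or light-like trajectory of a test particle of electric charge $e\in\mathbb R$ in the Kerr--Newman--(anti) de Sitter spacetime with parameters $\Lambda,M,Q,a$, where $I\subset\mathbb R$ is an open interval containing $0$ with affine parameter $\ell$, and assume that $\gamma$ takes values in $\{\Sigma\Delta_r\Delta_\theta\sin\theta\neq 0\}$. Let $(\mu,E,L,\kappa)$ be its constants of motion, and put $W_r:=\chi(E(r^2+a^2)-aL)+eQr$ and $W_\theta:=\chi(aE\sin\theta-L/\sin\theta)$. Then $(t,r,p_r,\theta,p_\theta,\phi)$ satisfies on $I$ the first order autonomous differential system $$\frac{\Sigma}{\chi}\dot t=\frac{W_r(r^2+a^2)}{\Delta_r}-\frac{aW_\theta\sin\theta}{\Delta_\theta},$$ $$\Sigma\dot r=\Delta_r p_r,$$ $$\Sigma\dot p_r=\frac{\frac{\partial W_r^2}{\partial r}-\Delta_r'(\kappa-\mu r^2)}{2\Delta_r}+\mu r-\Delta_r'p_r^2,$$ $$\Sigma\dot\theta=\Delta_\theta p_\theta,$$ $$\Sigma\dot p_\theta=\frac{-\frac{\partial W_\theta^2}{\partial\theta}+\Delta_\theta'(\kappa+\mu a^2\cos^2\theta)}{2\Delta_\theta}-\mu a^2\cos\theta\sin\theta-\Delta_\theta'p_\theta^2,$$ $$\frac{\Sigma}{\chi}\dot\phi=\frac{aW_r}{\Delta_r}-\frac{W_\theta}{\Delta_\theta\sin\theta},$$ where $\Delta_r'=\partial\Delta_r/\partial r$, $\Delta_\theta'=\partial\Delta_\theta/\partial\theta$,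 and the dot denotes $\mathrm d/\mathrm d\ell$.
   Context: Kerr--Newman--(anti) de Sitter (KNdS) spacetime: $\mathcal M=\mathbb R^2\times\mathbb S^2$ with Boyer--Lindquist coordinates $(t,r,\theta,\phi)$, where $(\theta,\phi)$ are spherical coordinates on $\mathbb S^2$. Fix constants $\Lambda\in\mathbb R$, $M,Q,J\ge 0$, and set $a:=J/M$ if $M\ne0$, $a:=J$ otherwise; $\lambda:=\Lambda/3$, $\chi:=1+\lambda a^2$ (assumed $\neq0$), and $$\Sigma:=r^2+a^2\cos^2\theta,\quad \Delta_r:=(1-\lambda r^2)(r^2+a^2)-2Mr+Q^2,\quad \Delta_\theta:=1+\lambda a^2\cos^2\theta.$$ On $\{\Sigma\Delta_r\Delta_\theta\sin\theta\neq0\}$ the metric $g$ (signature $(-,+,+,+)$, units $G=c=4\pi\epsilon_0=1$) is $$\mathrm ds^2=-\frac{\Delta_r}{\chi^2\Sigma}(\mathrm dt-a\sin^2\theta\,\mathrm d\phi)^2+\frac{\Delta_\theta\sin^2\theta}{\chi^2\Sigma}(a\,\mathrm dt-(r^2+a^2)\mathrm d\phi)^2+\Sigma\left(\frac{\mathrm dr^2}{\Delta_r}+\frac{\mathrm d\theta^2}{\Delta_\theta}\right).$$ The electromagnetic vector potential is $A=\frac{Qr}{\chi\Sigma}(\mathrm dt-a\sin^2\theta\,\mathrm d\phi)$, and $F_{\mu\nu}=\partial_\mu A_\nu-\partial_\nu A_\mu$. The trajectory (''geodesic'') of a test particle of charge $e$ is a solution of $\ddot\gamma^\mu+\Gamma^\mu{}_{\alpha\beta}\dot\gamma^\alpha\dot\gamma^\beta=eF^\mu{}_\alpha\dot\gamma^\alpha$,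 with $\Gamma^\mu{}_{\alpha\beta}$ the Christoffel symbols of $g$. The conjugate momenta are $p_\mu:=g_{\mu\nu}\dot\gamma^\nu+eA_\mu$. The constants of motion are: - $\mu:=g^{\alpha\beta}(p_\alpha-eA_\alpha)(p_\beta-eA_\beta)=g_{\alpha\beta}\dot\gamma^\alpha\dot\gamma^\beta$, equal to $-m^2$ with $m$ the rest mass; - $E:=-p_t$ (energy) and $L:=p_\phi$ (azimuthal angular momentum); - the Carter constant $\kappa:=\Delta_\theta p_\theta^2+\frac{W_\theta^2}{\Delta_\theta}-\mu a^2\cos^2\theta=-\Delta_r p_r^2+\frac{W_r^2}{\Delta_r}+\mu r^2$ (the two expressions agree and are constant along $\gamma$). In $\partial W_r^2/\partial r$ and $\partial W_\theta^2/\partial\theta$, $W_r$ is viewed as a function of $r$ and $W_\theta$ as a function of $\theta$, with $E,L$ constant. *)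

(* Defs.v *)
(* Stdlib reals with Coquelicot. *)
From Stdlib Require Import Reals ClassicalEpsilon.
From Coquelicot Require Import Coquelicot.
Open Scope R_scope.

(** * Tensor components in a four-dimensional coordinate chart *)

(** Boyer-Lindquist coordinates t, r, theta, phi. *)
Inductive coord : Set := ct | cr | cth | cph.

Definition coord_eq_dec (i j : coord) : {i = j} + {i <> j}.
Proof. decide equality. Defined.

Definition delta (i j : coord) : R := if coord_eq_dec i j then 1 else 0.

Definition sumc (f : coord -> R) : R := f ct + f cr + f cth + f cph.

Definition point := coord -> R.
Definition covector := coord -> R.
Definition matrix := coord -> coord -> R.

Definition upd (x : point) (i : coord) (s : R) : point :=
  fun j => if coord_eq_dec i j then s else x j.

Definition partial (i : coord) (f : point -> R) (x : point) : R :=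
  Derive (fun s => f (upd x i s)) (x i).

Definition is_inverse (G H : matrix) : Prop :=
  forall i j, sumc (fun k => G i k * H k j) = delta i j /\
              sumc (fun k => H i k * G k j) = delta i j.

(** The inverse matrix; unspecified when [G] is singular. *)
Definition inverse (G : matrix) : matrix :=
  epsilon (inhabits (fun _ _ => 0)) (is_inverse G).

(** [christoffel g x m i j] is the symbol with upper index [m]. *)
Definition christoffel (g : point -> matrix) (x : point) (m i j : coord) : R :=
  / 2 * sumc (fun n => inverse (g x) m n *
    (partial i (fun y => g y n j) x + partial j (fun y => g y n i) x
     - partial n (fun y => g y i j) x)).

(** The field F = dA and its version with first index raised. *)
Definition field_strength (A : point -> covector) (x : point) : matrix :=
  fun i j => partial i (fun y => A y j) x - partial j (fun y => A y i) x.

Definition field_strength_up (g : point -> matrix) (A : point -> covector)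
    (x : point) : matrix :=
  fun m i => sumc (fun n => inverse (g x) m n * field_strength A x n i).

Definition velocity (gamma : R -> point) (l : R) : coord -> R :=
  fun i => Derive (fun s => gamma s i) l.

Definition acceleration (gamma : R -> point) (l : R) : coord -> R :=
  fun i => Derive (fun s => velocity gamma s i) l.

Definition qform (G : matrix) (v : coord -> R) : R :=
  sumc (fun i => sumc (fun j => G i j * v i * v j)).

(** * Kerr-Newman-(anti) de Sitter spacetime *)

(** [cosmo], [mass], [charge], [angmom] are Lambda, M, Q, J. *)
Record KNdS := mkKNdS { cosmo : R; mass : R; charge : R; angmom : R }.

Definition spin (k : KNdS) : R :=
  if Req_EM_T (mass k) 0 then angmom k else angmom k / mass k.

Definition lambda (k : KNdS) : R := cosmo k / 3.

Definition chi (k : KNdS) : R := 1 + lambda k * spin k ^ 2.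

Definition Sigma (k : KNdS) (r theta : R) : R :=
  r ^ 2 + spin k ^ 2 * cos theta ^ 2.

Definition Delta_r (k : KNdS) (r : R) : R :=
  (1 - lambda k * r ^ 2) * (r ^ 2 + spin k ^ 2) - 2 * mass k * r + charge k ^ 2.

Definition Delta_theta (k : KNdS) (theta : R) : R :=
  1 + lambda k * spin k ^ 2 * cos theta ^ 2.

(** Domain of the metric in the chart: theta is the polar angle of the sphere,
    whereas the azimuth phi is lifted to the real line. *)
Definition regular (k : KNdS) (x : point) : Prop :=
  0 <= x cth <= PI /\
  Sigma k (x cr) (x cth) * Delta_r k (x cr) * Delta_theta k (x cth) * sin (x cth)
    <> 0.

(** The covectors dt - a sin^2(theta) dphi and a dt - (r^2 + a^2) dphi;
    [delta i] is the coordinate differential dx^i. *)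
Definition form_r (k : KNdS) (x : point) : covector :=
  fun i => delta ct i - spin k * sin (x cth) ^ 2 * delta cph i.

Definition form_theta (k : KNdS) (x : point) : covector :=
  fun i => spin k * delta ct i - (x cr ^ 2 + spin k ^ 2) * delta cph i.

Definition metric (k : KNdS) (x : point) : matrix :=
  fun i j =>
    - (Delta_r k (x cr) / (chi k ^ 2 * Sigma k (x cr) (x cth)))
        * (form_r k x i * form_r k x j)
    + Delta_theta k (x cth) * sin (x cth) ^ 2
        / (chi k ^ 2 * Sigma k (x cr) (x cth))
        * (form_theta k x i * form_theta k x j)
    + Sigma k (x cr) (x cth) *
        (delta cr i * delta cr j / Delta_r k (x cr)
         + delta cth i * delta cth j / Delta_theta k (x cth)).

Definition potential (k : KNdS) (x : point) : covector :=
  fun i => charge k * x cr / (chi k * Sigma k (x cr) (x cth)) * form_r k x i.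

(** * Trajectories of charged test particles *)

Definition Rbar_interval (lo hi : Rbar) (l : R) : Prop :=
  Rbar_lt lo l /\ Rbar_lt l hi.

Definition curve (t r theta phi : R -> R) : R -> point :=
  fun l i => match i with
             | ct => t l | cr => r l | cth => theta l | cph => phi l
             end.

Definition trajectory (k : KNdS) (e : R) (I : R -> Prop) (gamma : R -> point) :
    Prop :=
  forall l, I l ->
    (forall i, ex_derive (fun s => gamma s i) l /\
               ex_derive (fun s => velocity gamma s i) l) /\
    forall m,
      acceleration gamma l m
      + sumc (fun i => sumc (fun j =>
          christoffel (metric k) (gamma l) m i j
            * velocity gamma l i * velocity gamma l j))
      = e * sumc (fun i =>
          field_strength_up (metric k) (potential k) (gamma l) m i
            * velocity gamma l i).

Definition timelike (k : KNdS) (I : R -> Prop) (gamma : R -> point) : Prop :=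
  forall l, I l -> qform (metric k (gamma l)) (velocity gamma l) < 0.

Definition lightlike (k : KNdS) (I : R -> Prop) (gamma : R -> point) : Prop :=
  forall l, I l -> qform (metric k (gamma l)) (velocity gamma l) = 0 /\
                   exists i, velocity gamma l i <> 0.

Definition momentum (k : KNdS) (e : R) (gamma : R -> point) (l : R) : covector :=
  fun i => sumc (fun j => metric k (gamma l) i j * velocity gamma l j)
           + e * potential k (gamma l) i.

Definition W_r (k : KNdS) (e E L r : R) : R :=
  chi k * (E * (r ^ 2 + spin k ^ 2) - spin k * L) + e * charge k * r.

Definition W_theta (k : KNdS) (E L theta : R) : R :=
  chi k * (spin k * E * sin theta - L / sin theta).

(** ** The conserved quantities, evaluated at parameter [l] *)

Definition mu_at (k : KNdS) (e : R) (gamma : R -> point) (l : R) : R :=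
  qform (inverse (metric k (gamma l)))
        (fun i => momentum k e gamma l i - e * potential k (gamma l) i).

Definition energy_at (k : KNdS) (e : R) (gamma : R -> point) (l : R) : R :=
  - momentum k e gamma l ct.

Definition angmom_at (k : KNdS) (e : R) (gamma : R -> point) (l : R) : R :=
  momentum k e gamma l cph.

Definition carter_at (k : KNdS) (e : R) (gamma : R -> point) (l : R) : R :=
  let theta := gamma l cth in
  Delta_theta k theta * momentum k e gamma l cth ^ 2
  + W_theta k (energy_at k e gamma l) (angmom_at k e gamma l) theta ^ 2
      / Delta_theta k theta
  - mu_at k e gamma l * spin k ^ 2 * cos theta ^ 2.

(** They do not depend on the parameter along a trajectory, so their values at
    the parameter 0 determine the constants of motion. *)
Definition constants_of_motion (k : KNdS) (e : R) (gamma : R -> point)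
    (mu E L kappa : R) : Prop :=
  mu = mu_at k e gamma 0 /\ E = energy_at k e gamma 0 /\
  L = angmom_at k e gamma 0 /\ kappa = carter_at k e gamma 0.

(* Main.v *)
(** The equation of motion is the Euler-Lagrange equation of
    [L = g(v, v) / 2 + e A(v)], so [p_mu' = dL/dx^mu] with the velocity frozen.
    As this Lagrangian does not depend on [t] and [phi], energy and angular
    momentum are constant; so is
    [mu = g(v, v)], since the force [e F] is skew-symmetric. In the coframe
    [x = dt - a sin^2 dphi], [y = a dt - (r^2 + a^2) dphi] one has
    [W_r = Delta_r x / chi] and [W_theta = Delta_theta sin(theta) y / chi], and
    [Sigma dL/dr], [Sigma dL/dtheta] become rational identities giving the
    equations for [p_r] and [p_theta]. The latter, with the Carter constant taken
    at the current parameter, makes the derivative of that constant vanish. *)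

Require Import Defs.
From Stdlib Require Import Reals Lra ClassicalEpsilon FunctionalExtensionality.
From Coquelicot Require Import Coquelicot.
Open Scope R_scope.

(** * Index algebra: inverse matrices, lowering of indices, factorisation of the equation of
    motion *)

Lemma inverse_spec (G H : Defs.matrix) : is_inverse G H -> is_inverse G (inverse G).
Proof. intros HH. unfold inverse. apply epsilon_spec. now exists H. Qed.

Lemma sumc_ext (f h : coord -> R) : (forall i, f i = h i) -> sumc f = sumc h.
Proof. intros H. unfold sumc. now rewrite !H. Qed.

Lemma sumc_delta (S : coord -> R) (n : coord) :
  sumc (fun q => delta n q * S q) = S n.
Proof. destruct n; unfold sumc, delta; simpl; ring. Qed.

Lemma is_inverse_cancel (G H : Defs.matrix) (S : coord -> R) (n : coord) :
  is_inverse G H -> sumc (fun m => G n m * sumc (fun q => H m q * S q)) = S n.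
Proof.
intros HI.
transitivity (sumc (fun q => sumc (fun m => G n m * H m q) * S q)).
  unfold sumc; ring.
rewrite <- sumc_delta. apply sumc_ext. intros q. now rewrite (proj1 (HI n q)).
Qed.

Lemma is_inverse_sym (G H : Defs.matrix) : is_inverse G H -> is_inverse H G.
Proof. intros HI i j. destruct (HI i j). now split. Qed.

Lemma qform_sumc (G : Defs.matrix) (v : coord -> R) :
  qform G v = sumc (fun i => v i * sumc (fun j => G i j * v j)).
Proof. unfold qform, sumc; ring. Qed.

Lemma qform_inverse (G H : Defs.matrix) (v : coord -> R) :
  is_inverse G H -> qform H (fun i => sumc (fun j => G i j * v j)) = qform G v.
Proof.
intros HI. rewrite !qform_sumc. apply sumc_ext. intros i.
rewrite (is_inverse_cancel H G v i (is_inverse_sym _ _ HI)). ring.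
Qed.

(** Here [D i n j] stands for the derivative of [g n j] in direction [i], and [F] for the field
    strength with lower indices. Factoring out [H], the inverse metric, prepares the contraction
    with the metric in [lowered_equation]. *)
Lemma christoffel_factor (H : Defs.matrix) (D : coord -> Defs.matrix) (F : Defs.matrix)
    (v : coord -> R) (e w : R) (m : coord) :
  w + sumc (fun i => sumc (fun j =>
        / 2 * sumc (fun n => H m n * (D i n j + D j n i - D n i j)) * v i * v j))
    = e * sumc (fun i => sumc (fun n => H m n * F n i) * v i) ->
  w = sumc (fun n => H m n *
        (e * sumc (fun i => F n i * v i)
         - / 2 * sumc (fun i => sumc (fun j =>
             (D i n j + D j n i - D n i j) * v i * v j)))).
Proof.
intros HE.
match type of HE with _ + ?X = ?Y => replace w with (Y - X) by lra end.
clear HE w. unfold sumc. field.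
Qed.

(** * The chain rule along a curve *)

(** A substitute for differentiability of [f] at [gamma l] which is stable under
    arithmetic operations and is all that the Euler-Lagrange equations need. *)
Definition chain_at (gamma : R -> point) (l : R) (f : point -> R) : Prop :=
  (forall i, ex_derive (fun s => f (upd (gamma l) i s)) (gamma l i)) /\
  is_derive (fun s => f (gamma s)) l
    (sumc (fun i => partial i f (gamma l) * velocity gamma l i)).

Lemma upd_self (x : point) (i : coord) : upd x i (x i) = x.
Proof.
apply functional_extensionality. intros j. unfold upd.
now destruct (coord_eq_dec i j) as [<-|].
Qed.

Section Chain.
Variables (gamma : R -> point) (l : R).

(** The numbers [da] and [db] are the partial derivatives of [op] at the values of [f] and [h]. The
    hypothesis quantifies over all [u], [v], [s] because it serves twice: on each coordinate line
    through [gamma l], and on the curve itself. *)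
Lemma chain_at_op2 (op : R -> R -> R) (da db : R) (f h : point -> R) :
  (forall (u v : R -> R) s du dv, u s = f (gamma l) -> v s = h (gamma l) ->
    is_derive u s du -> is_derive v s dv ->
    is_derive (fun s => op (u s) (v s)) s (da * du + db * dv)) ->
  chain_at gamma l f -> chain_at gamma l h ->
  chain_at gamma l (fun x => op (f x) (h x)).
Proof.
intros hop [f1 f2] [h1 h2].
assert (P : forall i, is_derive
   (fun s => op (f (upd (gamma l) i s)) (h (upd (gamma l) i s))) (gamma l i)
   (da * partial i f (gamma l) + db * partial i h (gamma l))).
{ intros i. apply hop; try (now rewrite upd_self); apply Derive_correct; auto. }
split.
{ intros i. eexists; apply P. }
replace (sumc _) with
 (da * sumc (fun i => partial i f (gamma l) * velocity gamma l i)
  + db * sumc (fun i => partial i h (gamma l) * velocity gamma l i)).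
{ apply hop; auto. }
transitivity (sumc (fun i => (da * partial i f (gamma l) + db * partial i h (gamma l))
   * velocity gamma l i)).
{ unfold sumc; ring. }
apply sumc_ext. intros i. f_equal. symmetry. apply (is_derive_unique _ _ _ (P i)).
Qed.

Lemma chain_at_const (c : R) : chain_at gamma l (fun _ => c).
Proof.
assert (P : forall i, partial i (fun _ => c) (gamma l) = 0).
{ intros i. exact (Derive_const c (gamma l i)). }
split.
{ intros i. apply ex_derive_const. }
replace (sumc _) with 0 by (unfold sumc; rewrite !P; ring).
apply (is_derive_const c l).
Qed.

Lemma chain_at_coord (h : R -> R) (i : coord) :
  ex_derive (fun s => gamma s i) l -> ex_derive h (gamma l i) ->
  chain_at gamma l (fun x => h (x i)).
Proof.
intros hg hh.
assert (P : forall j, is_derive (fun s => h (upd (gamma l) j s i)) (gamma l j)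
   (Derive h (gamma l i) * delta i j)).
{ intros j. unfold upd, delta.
  destruct (coord_eq_dec j i) as [->|ne].
  - destruct (coord_eq_dec i i) as [_|]; [|easy]. rewrite Rmult_1_r.
    now apply Derive_correct.
  - destruct (coord_eq_dec i j) as [->|_]; [easy|]. rewrite Rmult_0_r.
    apply (is_derive_const (h (gamma l i))). }
split.
{ intros j. eexists; apply P. }
replace (sumc _) with (velocity gamma l i * Derive h (gamma l i)).
{ apply (is_derive_comp h (fun s => gamma s i)); now apply Derive_correct. }
transitivity (sumc (fun j => Derive h (gamma l i) * delta i j * velocity gamma l j)).
{ rewrite <- (sumc_delta (velocity gamma l) i). unfold sumc; ring. }
apply sumc_ext. intros j. f_equal. symmetry. apply (is_derive_unique _ _ _ (P j)).
Qed.

Lemma chain_at_plus (f h : point -> R) :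
  chain_at gamma l f -> chain_at gamma l h -> chain_at gamma l (fun x => f x + h x).
Proof.
apply (chain_at_op2 Rplus 1 1). intros u v s du dv _ _ hu hv. rewrite !Rmult_1_l.
exact (is_derive_plus u v s du dv hu hv).
Qed.

Lemma chain_at_mult (f h : point -> R) :
  chain_at gamma l f -> chain_at gamma l h -> chain_at gamma l (fun x => f x * h x).
Proof.
apply (chain_at_op2 Rmult (h (gamma l)) (f (gamma l))).
intros u v s du dv hu0 hv0 hu hv. rewrite <- hu0, <- hv0.
replace (_ + _) with (du * v s + u s * dv) by ring.
apply (is_derive_mult u v s du dv hu hv). intros; apply Rmult_comm.
Qed.

Lemma chain_at_div (f h : point -> R) :
  h (gamma l) <> 0 ->
  chain_at gamma l f -> chain_at gamma l h -> chain_at gamma l (fun x => f x / h x).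
Proof.
intros h0.
apply (chain_at_op2 Rdiv (/ h (gamma l)) (- f (gamma l) / h (gamma l) ^ 2)).
intros u v s du dv hu0 hv0 hu hv. rewrite <- hu0, <- hv0.
replace (_ + _) with ((du * v s - u s * dv) / v s ^ 2) by (field; congruence).
apply (is_derive_div u v s du dv hu hv). congruence.
Qed.

Lemma chain_at_opp (f : point -> R) :
  chain_at gamma l f -> chain_at gamma l (fun x => - f x).
Proof.
(* Negation is taken as a binary operation ignoring its second argument, hence the weight 0. *)
intros hf. apply (chain_at_op2 (fun u _ => - u) (-1) 0 f f); auto.
intros u v s du dv _ _ hu _. replace (_ + _) with (- du) by ring.
exact (is_derive_opp u s du hu).
Qed.
End Chain.

Lemma is_derive_sumc (f : R -> coord -> R) (l : R) (df : coord -> R) :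
  (forall i, is_derive (fun s => f s i) l (df i)) ->
  is_derive (fun s => sumc (f s)) l (sumc df).
Proof. intros H. unfold sumc. repeat apply (is_derive_plus (V := R_NormedModule)); auto. Qed.

(** * Euler-Lagrange equations *)

Lemma is_derive_Rmult (f h : R -> R) x df dh :
  is_derive f x df -> is_derive h x dh ->
  is_derive (fun s => f s * h s) x (df * h x + f x * dh).
Proof. intros Hf Hh. apply (is_derive_mult f h x df dh Hf Hh). intros; apply Rmult_comm. Qed.

Section EulerLagrange.
Variables (g : point -> Defs.matrix) (A : point -> covector) (e : R).
Variables (gamma : R -> point) (l : R).
Hypothesis g_sym : forall x i j, g x i j = g x j i.
Hypothesis g_inv : is_inverse (g (gamma l)) (inverse (g (gamma l))).
Hypothesis g_chain : forall i j, chain_at gamma l (fun x => g x i j).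
Hypothesis A_chain : forall i, chain_at gamma l (fun x => A x i).
Hypothesis gamma_ex : forall i, ex_derive (fun s => velocity gamma s i) l.
Hypothesis eqn : forall m,
  acceleration gamma l m
  + sumc (fun i => sumc (fun j =>
      christoffel g (gamma l) m i j * velocity gamma l i * velocity gamma l j))
  = e * sumc (fun i => field_strength_up g A (gamma l) m i * velocity gamma l i).

Let v := velocity gamma l.
Let w := acceleration gamma l.
Let D k i j := partial k (fun y => g y i j) (gamma l).
Let B k i := partial k (fun y => A y i) (gamma l).

(** By [christoffel_factor] the acceleration is the inverse metric applied to a covector, so
    applying the metric returns that covector. *)
Lemma lowered_equation (n : coord) :
  sumc (fun m => g (gamma l) n m * w m)
  = e * sumc (fun i => (B n i - B i n) * v i)
    - / 2 * sumc (fun i => sumc (fun j =>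
        (D i n j + D j n i - D n i j) * v i * v j)).
Proof.
rewrite <- (is_inverse_cancel _ _ (fun n => e * sumc (fun i => (B n i - B i n) * v i)
    - / 2 * sumc (fun i => sumc (fun j =>
        (D i n j + D j n i - D n i j) * v i * v j))) n g_inv).
apply sumc_ext. intros m. f_equal.
exact (christoffel_factor _ D (field_strength A (gamma l)) v e (w m) m (eqn m)).
Qed.

Lemma is_derive_metric i j :
  is_derive (fun s => g (gamma s) i j) l (sumc (fun k => D k i j * v k)).
Proof. apply (g_chain i j). Qed.

Lemma is_derive_velocity i : is_derive (fun s => velocity gamma s i) l (w i).
Proof. apply Derive_correct, gamma_ex. Qed.

(** The right-hand side differentiates the Lagrangian with the velocity frozen at
    its value at parameter [l]. *)
Lemma euler_lagrange (n : coord) :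
  is_derive (fun s => sumc (fun j => g (gamma s) n j * velocity gamma s j)
                      + e * A (gamma s) n) l
    (partial n (fun y => / 2 * qform (g y) v + e * sumc (fun i => A y i * v i))
       (gamma l)).
Proof.
assert (P : is_derive (fun s => / 2 * qform (g (upd (gamma l) n s)) v
     + e * sumc (fun i => A (upd (gamma l) n s) i * v i)) (gamma l n)
   (/ 2 * sumc (fun i => sumc (fun j => D n i j * v i * v j))
    + e * sumc (fun i => B n i * v i))).
{ apply (is_derive_plus (V := R_NormedModule)); apply is_derive_scal.
  - unfold qform. apply is_derive_sumc. intros i. apply is_derive_sumc. intros j.
    apply (is_derive_ext (fun s => scal (v i * v j) (g (upd (gamma l) n s) i j))).
    { intros s. unfold scal; simpl; unfold mult; simpl. ring. }
    replace (D n i j * v i * v j) with ((v i * v j) * D n i j) by ring.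
    apply is_derive_scal, Derive_correct, (g_chain i j).
  - apply is_derive_sumc. intros i.
    apply (is_derive_ext (fun s => scal (v i) (A (upd (gamma l) n s) i))).
    { intros s. unfold scal; simpl; unfold mult; simpl. ring. }
    replace (B n i * v i) with (v i * B n i) by ring.
    apply is_derive_scal, Derive_correct, (A_chain i). }
rewrite (is_derive_unique _ _ _ P : partial n _ (gamma l) = _). clear P.
(* This is the product rule for the momentum: derivative of the metric times velocity, metric times
   acceleration, and derivative of the potential. *)
replace (/ 2 * _ + _) with
  (sumc (fun j => sumc (fun k => D k n j * v k) * v j + g (gamma l) n j * w j)
   + e * sumc (fun k => B k n * v k)).
{ apply (is_derive_plus (V := R_NormedModule)).
  - apply is_derive_sumc. intros j.
    apply is_derive_Rmult; [apply is_derive_metric|apply is_derive_velocity].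
  - apply is_derive_scal. apply (A_chain n). }
transitivity (sumc (fun j => sumc (fun k => D k n j * v k) * v j)
  + sumc (fun m => g (gamma l) n m * w m) + e * sumc (fun k => B k n * v k)).
{ unfold sumc; ring. }
(* Exchanging i and j, the sums over [D i n j] and [D j n i] coincide and together cancel the
   derivative of the metric; the terms in [B i n] cancel as well. *)
rewrite lowered_equation. unfold sumc. field.
Qed.

(** Contracted with the velocity, the field term of [lowered_equation] vanishes by skew symmetry,
    and its three metric terms reduce to one. Twice the result cancels the derivative of the
    metric. *)
Lemma is_derive_qform_velocity :
  is_derive (fun s => qform (g (gamma s)) (velocity gamma s)) l 0.
Proof.
replace 0 with (sumc (fun i => sumc (fun j =>
  (sumc (fun k => D k i j * v k) * v i + g (gamma l) i j * w i) * v j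
  + g (gamma l) i j * v i * w j))).
{ unfold qform. apply is_derive_sumc. intros i. apply is_derive_sumc. intros j.
  apply (is_derive_Rmult (fun s => g (gamma s) i j * velocity gamma s i));
    [apply is_derive_Rmult|]; first [apply is_derive_metric|apply is_derive_velocity]. }
transitivity (sumc (fun i => sumc (fun j => sumc (fun k => D k i j * v k) * v i * v j))
  + 2 * sumc (fun i => v i * sumc (fun j => g (gamma l) i j * w j))).
(* Symmetry of [g] makes the two terms containing the acceleration equal. *)
{ transitivity (sumc (fun i => sumc (fun j =>
    sumc (fun k => D k i j * v k) * v i * v j
    + g (gamma l) j i * v j * w i + g (gamma l) i j * v i * w j))).
  { apply sumc_ext. intros i. apply sumc_ext. intros j. rewrite (g_sym _ j i). ring. }
  unfold sumc; ring. }
rewrite (sumc_ext _ _ (fun i => f_equal (Rmult (v i)) (lowered_equation i))).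
unfold sumc. field.
Qed.
End EulerLagrange.

(** * Separation in Kerr-Newman-(anti) de Sitter spacetime *)

Section Spacetime.
Variables (k : KNdS) (e : R).
Hypothesis chi_neq0 : chi k <> 0.

Let omega_r (theta : R) (v : coord -> R) : R :=
  v ct - spin k * sin theta ^ 2 * v cph.
Let omega_theta (r : R) (v : coord -> R) : R :=
  spin k * v ct - (r ^ 2 + spin k ^ 2) * v cph.

(** Taking only r and theta as position arguments makes the independence from t and phi visible by
    conversion. [omega_r] and [omega_theta] are the values of [form_r] and [form_theta] on the
    velocity. *)
Definition lagrangian (r theta : R) (v : coord -> R) : R :=
  / 2 * (- (Delta_r k r / (chi k ^ 2 * Sigma k r theta)) * omega_r theta v ^ 2
    + Delta_theta k theta * sin theta ^ 2 / (chi k ^ 2 * Sigma k r theta)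
        * omega_theta r v ^ 2
    + Sigma k r theta * (v cr ^ 2 / Delta_r k r + v cth ^ 2 / Delta_theta k theta))
  + e * (charge k * r / (chi k * Sigma k r theta) * omega_r theta v).

Lemma lagrangianE (x : point) (v : coord -> R) :
  / 2 * qform (metric k x) v + e * sumc (fun i => potential k x i * v i)
  = lagrangian (x cr) (x cth) v.
Proof.
unfold lagrangian, qform, metric, potential, form_r, form_theta, omega_r,
  omega_theta, sumc, delta; simpl. unfold Rdiv; ring.
Qed.

Lemma regular_neq0 (x : point) : regular k x ->
  Sigma k (x cr) (x cth) <> 0 /\ Delta_r k (x cr) <> 0 /\
  Delta_theta k (x cth) <> 0 /\ sin (x cth) <> 0.
Proof.
intros [_ H].
repeat split; intros H0; apply H; rewrite H0; ring.
Qed.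

(** Writing Sigma by the sine alone removes the trigonometric relation from the later identities,
    which [field] then proves with the sine as an independent variable. *)
Lemma SigmaE (r theta : R) :
  Sigma k r theta = r ^ 2 + spin k ^ 2 * (1 - sin theta ^ 2).
Proof.
unfold Sigma. generalize (sin2_cos2 theta). unfold Rsqr. intros H.
replace (1 - sin theta ^ 2) with (cos theta ^ 2) by (simpl; lra). ring.
Qed.

Lemma ex_derive_Delta_r (r : R) : ex_derive (Delta_r k) r.
Proof. unfold Delta_r. auto_derive. easy. Qed.

Lemma ex_derive_Delta_theta (theta : R) : ex_derive (Delta_theta k) theta.
Proof. unfold Delta_theta. auto_derive. easy. Qed.

(** * Differentiability of the metric and the potential along the curve *)

Section Along.
Variables (gamma : R -> point) (l : R).
Hypothesis reg : regular k (gamma l).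
Hypothesis gamma_ex : forall i, ex_derive (fun s => gamma s i) l.

Lemma chain_at_Sigma : chain_at gamma l (fun x => Sigma k (x cr) (x cth)).
Proof.
apply chain_at_plus.
- apply (chain_at_coord gamma l (fun r => r ^ 2)); auto. auto_derive; easy.
- apply (chain_at_coord gamma l (fun th => spin k ^ 2 * cos th ^ 2)); auto.
  auto_derive; easy.
Qed.

Lemma chain_at_form_r i : chain_at gamma l (fun x => form_r k x i).
Proof.
apply (chain_at_coord gamma l
  (fun th => delta ct i - spin k * sin th ^ 2 * delta cph i)); auto.
auto_derive; easy.
Qed.

Lemma chain_at_form_theta i : chain_at gamma l (fun x => form_theta k x i).
Proof.
apply (chain_at_coord gamma l
  (fun r => spin k * delta ct i - (r ^ 2 + spin k ^ 2) * delta cph i)); auto.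
auto_derive; easy.
Qed.

Lemma chain_at_metric i j : chain_at gamma l (fun x => metric k x i j).
Proof.
destruct (regular_neq0 _ reg) as (S0 & R0 & T0 & _).
assert (hS : chain_at gamma l (fun x => chi k ^ 2 * Sigma k (x cr) (x cth))).
{ apply chain_at_mult; [apply chain_at_const|apply chain_at_Sigma]. }
assert (hS0 : chi k ^ 2 * Sigma k (gamma l cr) (gamma l cth) <> 0).
{ apply Rmult_integral_contrapositive_currified; [now apply pow_nonzero|easy]. }
assert (hR : chain_at gamma l (fun x => Delta_r k (x cr))).
{ apply chain_at_coord; auto using ex_derive_Delta_r. }
assert (hT : chain_at gamma l (fun x => Delta_theta k (x cth))).
{ apply chain_at_coord; auto using ex_derive_Delta_theta. }
apply chain_at_plus; [apply chain_at_plus|]; apply chain_at_mult.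
- apply chain_at_opp, chain_at_div; auto.
- apply chain_at_mult; apply chain_at_form_r.
- apply chain_at_div; auto. apply chain_at_mult; auto.
  apply (chain_at_coord gamma l (fun th => sin th ^ 2)); auto. auto_derive; easy.
- apply chain_at_mult; apply chain_at_form_theta.
- apply chain_at_Sigma.
- apply chain_at_plus; apply chain_at_div; auto using chain_at_const.
Qed.

Lemma chain_at_potential i : chain_at gamma l (fun x => potential k x i).
Proof.
destruct (regular_neq0 _ reg) as (S0 & _).
apply chain_at_mult; [apply chain_at_div|apply chain_at_form_r].
- now apply Rmult_integral_contrapositive_currified.
- apply (chain_at_coord gamma l (fun r => charge k * r)); auto. auto_derive; easy.
- apply chain_at_mult; [apply chain_at_const|apply chain_at_Sigma].
Qed.
End Along.

(** * The inverse metric and the partial derivatives of the Lagrangian *)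

Lemma metric_sym (x : point) (i j : coord) : metric k x i j = metric k x j i.
Proof. unfold metric, Rdiv. ring. Qed.

(** [X_r] and [X_theta], suitably scaled, are dual to [form_r], [form_theta]. *)
Definition inverse_metric (x : point) : Defs.matrix :=
  let X_r i := (x cr ^ 2 + spin k ^ 2) * delta ct i + spin k * delta cph i in
  let X_theta i := spin k * sin (x cth) ^ 2 * delta ct i + delta cph i in
  let S := Sigma k (x cr) (x cth) in
  fun i j =>
    - (chi k ^ 2 / (Delta_r k (x cr) * S)) * (X_r i * X_r j)
    + chi k ^ 2 / (Delta_theta k (x cth) * sin (x cth) ^ 2 * S)
        * (X_theta i * X_theta j)
    + (Delta_r k (x cr) * (delta cr i * delta cr j)
       + Delta_theta k (x cth) * (delta cth i * delta cth j)) / S.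

Lemma inverse_metricP (x : point) :
  regular k x -> is_inverse (metric k x) (inverse_metric x).
Proof.
intros (S0 & R0 & T0 & s0)%regular_neq0 i j.
assert (P : forall i j,
  sumc (fun n => metric k x i n * inverse_metric x n j) = delta i j).
{ clear i j. intros i j.
  unfold metric, inverse_metric, form_r, form_theta.
  rewrite SigmaE in *.
  destruct i, j; unfold sumc, delta; simpl coord_eq_dec; cbv iota; field; auto. }
split; [apply P|].
(* Both matrices are symmetric, so the product in the other order is the transpose of the one just
   computed. *)
transitivity (sumc (fun n => metric k x j n * inverse_metric x n i)).
{ apply sumc_ext. intros n. rewrite (metric_sym x n j).
  unfold inverse_metric, Rdiv. ring. }
rewrite P. unfold delta. destruct i, j; reflexivity.
Qed.

(** The explicit inverse guarantees that the [epsilon] choice in [inverse] is a genuine inverse. *)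
Lemma inverse_metric_spec (x : point) :
  regular k x -> is_inverse (metric k x) (inverse (metric k x)).
Proof. intros H. eapply inverse_spec, inverse_metricP, H. Qed.

(** The derivative of [Delta_r] stays symbolic: the separated equation is a rational identity in it
    and in the values of [Delta_r] and [Delta_theta]. *)
Definition lagrangian_dr (r theta : R) (v : coord -> R) : R :=
  let S := Sigma k r theta in
  let R' := Derive (Delta_r k) r in
  let Dr := Delta_r k r in
  let Dt := Delta_theta k theta in
  let x := omega_r theta v in
  let y := omega_theta r v in
  / 2 * (- (R' * S - Dr * (2 * r)) / (chi k ^ 2 * S ^ 2) * x ^ 2
    - Dt * sin theta ^ 2 * (2 * r) / (chi k ^ 2 * S ^ 2) * y ^ 2
    - Dt * sin theta ^ 2 / (chi k ^ 2 * S) * (4 * r * v cph * y)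
    + 2 * r * (v cr ^ 2 / Dr + v cth ^ 2 / Dt) - S * R' * v cr ^ 2 / Dr ^ 2)
  + e * charge k * (S - 2 * r ^ 2) / (chi k * S ^ 2) * x.

Lemma is_derive_lagrangian_r (r theta : R) (v : coord -> R) :
  Sigma k r theta <> 0 -> Delta_r k r <> 0 -> Delta_theta k theta <> 0 ->
  is_derive (fun s => lagrangian s theta v) r (lagrangian_dr r theta v).
Proof.
intros S0 R0 T0.
unfold lagrangian, lagrangian_dr, omega_r, omega_theta, Sigma in *.
auto_derive.
- repeat split; auto using ex_derive_Delta_r;
    repeat apply Rmult_integral_contrapositive_currified; auto using R1_neq_R0.
- change (Derive (fun x => Delta_r k x) r) with (Derive (Delta_r k) r).
  field. rewrite ?Rpow_mult_distr; auto.
Qed.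

Definition lagrangian_dtheta (r theta : R) (v : coord -> R) : R :=
  let S := Sigma k r theta in
  let T' := Derive (Delta_theta k) theta in
  let Dr := Delta_r k r in
  let Dt := Delta_theta k theta in
  let s := sin theta in
  let c := cos theta in
  let a := spin k in
  let x := omega_r theta v in
  let y := omega_theta r v in
  / 2 * (- (2 * a ^ 2 * s * c * Dr) / (chi k ^ 2 * S ^ 2) * x ^ 2
    + Dr / (chi k ^ 2 * S) * (4 * a * s * c * v cph * x)
    + (T' * s ^ 2 + 2 * s * c * Dt) / (chi k ^ 2 * S) * y ^ 2
    + Dt * s ^ 2 * (2 * a ^ 2 * s * c) / (chi k ^ 2 * S ^ 2) * y ^ 2
    - 2 * a ^ 2 * s * c * (v cr ^ 2 / Dr + v cth ^ 2 / Dt)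
    - S * T' * v cth ^ 2 / Dt ^ 2)
  + e * charge k * r * (2 * a ^ 2 * s * c * x / (chi k * S ^ 2)
    - 2 * a * s * c * v cph / (chi k * S)).

Lemma is_derive_lagrangian_theta (r theta : R) (v : coord -> R) :
  Sigma k r theta <> 0 -> Delta_r k r <> 0 -> Delta_theta k theta <> 0 ->
  is_derive (fun s => lagrangian r s v) theta (lagrangian_dtheta r theta v).
Proof.
intros S0 R0 T0.
unfold lagrangian, lagrangian_dtheta, omega_r, omega_theta, Sigma in *.
auto_derive.
- repeat split; auto using ex_derive_Delta_theta;
    repeat apply Rmult_integral_contrapositive_currified; auto using R1_neq_R0.
- change (Derive (fun x => Delta_theta k x) theta) with (Derive (Delta_theta k) theta).
  field. rewrite ?Rpow_mult_distr; auto.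
Qed.

(** * Algebraic identities between velocity, momenta and conserved quantities at one parameter *)

Section Pointwise.
Variables (gamma : R -> point) (l : R).
Hypothesis reg : regular k (gamma l).
Let v := velocity gamma l.
Let x := omega_r (gamma l cth) v.
Let y := omega_theta (gamma l cr) v.
Let S := Sigma k (gamma l cr) (gamma l cth).
Let Dr := Delta_r k (gamma l cr).
Let Dt := Delta_theta k (gamma l cth).
Let Wr := W_r k e (energy_at k e gamma l) (angmom_at k e gamma l) (gamma l cr).
Let Wt := W_theta k (energy_at k e gamma l) (angmom_at k e gamma l) (gamma l cth).

(** With [velocity_cph], this solves the linear system defining [x] and [y] for the t and phi
    velocities; its determinant is minus Sigma. *)
Lemma velocity_ct : S * v ct = (gamma l cr ^ 2 + spin k ^ 2) * x
  - spin k * sin (gamma l cth) ^ 2 * y.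
Proof. unfold S, x, y, omega_r, omega_theta. rewrite SigmaE. ring. Qed.

Lemma velocity_cph : S * v cph = spin k * x - y.
Proof. unfold S, x, y, omega_r, omega_theta. rewrite SigmaE. ring. Qed.

Lemma momentum_cr : momentum k e gamma l cr = S * v cr / Dr.
Proof.
unfold momentum, metric, potential, form_r, form_theta, sumc, delta, Rdiv; simpl.
fold v S Dr. ring.
Qed.

Lemma momentum_cth : momentum k e gamma l cth = S * v cth / Dt.
Proof.
unfold momentum, metric, potential, form_r, form_theta, sumc, delta, Rdiv; simpl.
fold v S Dt. ring.
Qed.

Lemma energy_atE : energy_at k e gamma l =
  (Dr * x - Dt * sin (gamma l cth) ^ 2 * spin k * y) / (chi k ^ 2 * S)
  - e * charge k * gamma l cr / (chi k * S).
Proof.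
unfold energy_at, momentum, metric, potential, form_r, form_theta, sumc, delta,
  Rdiv; simpl.
fold v S Dr Dt. unfold x, y, omega_r, omega_theta. ring.
Qed.

Lemma angmom_atE : angmom_at k e gamma l =
  sin (gamma l cth) ^ 2 * ((Dr * spin k * x
    - Dt * (gamma l cr ^ 2 + spin k ^ 2) * y) / (chi k ^ 2 * S)
  - e * charge k * gamma l cr * spin k / (chi k * S)).
Proof.
unfold angmom_at, momentum, metric, potential, form_r, form_theta, sumc, delta,
  Rdiv; simpl.
fold v S Dr Dt. unfold x, y, omega_r, omega_theta. ring.
Qed.

(** In E (r^2 + a^2) - a L the [y] terms cancel, and the [x] terms and the charge terms acquire the
    factor r^2 + a^2 - a^2 sin^2 = Sigma. The summand [e * charge k * r] of [W_r] removes the charge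
    term. *)
Lemma W_rE : Wr = Dr * x / chi k.
Proof.
destruct (regular_neq0 _ reg) as (S0 & _).
unfold Wr, W_r. rewrite energy_atE, angmom_atE. unfold S. rewrite SigmaE in *.
field; auto.
Qed.

(** Dually, the [x] terms and the charge terms cancel, and the [y] terms acquire the factor
    Sigma. *)
Lemma W_thetaE : Wt = Dt * sin (gamma l cth) * y / chi k.
Proof.
destruct (regular_neq0 _ reg) as (S0 & _ & _ & s0).
unfold Wt, W_theta. rewrite energy_atE, angmom_atE. unfold S. rewrite SigmaE in *.
field; auto.
Qed.

(** Subtracting e A from the momentum leaves the velocity with its index lowered. *)
Lemma mu_atE : mu_at k e gamma l = qform (metric k (gamma l)) v.
Proof.
rewrite <- (qform_inverse _ _ v (inverse_metric_spec _ reg)).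
unfold mu_at. rewrite !qform_sumc. unfold sumc, momentum, sumc. fold v. ring.
Qed.

Lemma qformE : qform (metric k (gamma l)) v =
  - Dr * x ^ 2 / (chi k ^ 2 * S) + Dt * sin (gamma l cth) ^ 2 * y ^ 2 / (chi k ^ 2 * S)
  + S * (v cr ^ 2 / Dr + v cth ^ 2 / Dt).
Proof.
unfold qform, metric, form_r, form_theta, sumc, delta, Rdiv; simpl.
fold S Dr Dt. unfold x, y, omega_r, omega_theta. ring.
Qed.

Let mu := mu_at k e gamma l.
Let kappa := carter_at k e gamma l.
Let E := energy_at k e gamma l.
Let L := angmom_at k e gamma l.

(** By [qformE], Sigma mu = Delta_r p_r^2 - W_r^2 / Delta_r + Delta_theta p_theta^2 + W_theta^2 /
    Delta_theta. As Sigma = r^2 + a^2 cos^2 theta, this separates, and kappa is the separation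
    constant. *)
Lemma carter_at_r :
  kappa - mu * gamma l cr ^ 2 = - Dr * momentum k e gamma l cr ^ 2 + Wr ^ 2 / Dr.
Proof.
destruct (regular_neq0 _ reg) as (S0 & R0 & T0 & _).
unfold kappa, mu, carter_at. fold Wt Dt Dr.
rewrite mu_atE, qformE, momentum_cr, momentum_cth, W_rE, W_thetaE.
replace (cos (gamma l cth) ^ 2) with (1 - sin (gamma l cth) ^ 2)
  by (generalize (sin2_cos2 (gamma l cth)); unfold Rsqr; simpl; lra).
unfold S in *. rewrite SigmaE in *. field; auto.
Qed.

Lemma lagrangian_dr_separated :
  S * lagrangian_dr (gamma l cr) (gamma l cth) v
  = (Derive (fun r => W_r k e E L r ^ 2) (gamma l cr)
     - Derive (Delta_r k) (gamma l cr) * (kappa - mu * gamma l cr ^ 2)) / (2 * Dr)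
    + mu * gamma l cr
    - Derive (Delta_r k) (gamma l cr) * momentum k e gamma l cr ^ 2.
Proof.
destruct (regular_neq0 _ reg) as (S0 & R0 & T0 & _).
rewrite carter_at_r.
(* [E] and [L] are the values at the parameter [l], hence constants in this derivative. *)
replace (Derive (fun r => W_r k e E L r ^ 2) (gamma l cr)) with
  (2 * Wr * (2 * chi k * E * gamma l cr + e * charge k)).
2:{ symmetry. apply is_derive_unique. unfold Wr, W_r. fold E L. auto_derive; [easy|]. ring. }
unfold mu. rewrite mu_atE, qformE, momentum_cr, W_rE. unfold E. rewrite energy_atE.
unfold lagrangian_dr. fold S Dr Dt x y.
(* The phi velocity enters through the r derivative of [omega_theta]; expressing it by [x] and [y]
   leaves independent variables for [field]. *)
replace (v cph) with ((spin k * x - y) / S) by (rewrite <- velocity_cph; field; auto).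
unfold S in *. rewrite SigmaE in *. field; auto.
Qed.

Lemma lagrangian_dtheta_separated :
  S * lagrangian_dtheta (gamma l cr) (gamma l cth) v
  = (- Derive (fun th => W_theta k E L th ^ 2) (gamma l cth)
     + Derive (Delta_theta k) (gamma l cth)
         * (kappa + mu * spin k ^ 2 * cos (gamma l cth) ^ 2)) / (2 * Dt)
    - mu * spin k ^ 2 * cos (gamma l cth) * sin (gamma l cth)
    - Derive (Delta_theta k) (gamma l cth) * momentum k e gamma l cth ^ 2.
Proof.
destruct (regular_neq0 _ reg) as (S0 & R0 & T0 & s0).
(* In the theta equation this bracket comes directly from the definition of [carter_at]. *)
replace (kappa + _) with (Dt * momentum k e gamma l cth ^ 2 + Wt ^ 2 / Dt)
  by (unfold kappa, carter_at; fold Dt Wt; unfold mu; ring).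
replace (Derive (fun r => W_theta k E L r ^ 2) (gamma l cth)) with
  (2 * Wt * chi k * cos (gamma l cth) * (spin k * E + L / sin (gamma l cth) ^ 2)).
2:{ symmetry. apply is_derive_unique. unfold Wt, W_theta. fold E L. auto_derive; [easy|].
  field; auto. }
unfold mu. rewrite mu_atE, qformE, momentum_cth, W_thetaE. unfold E, L.
rewrite energy_atE, angmom_atE.
unfold lagrangian_dtheta. fold S Dr Dt x y.
replace (v cph) with ((spin k * x - y) / S) by (rewrite <- velocity_cph; field; auto).
unfold S in *. rewrite SigmaE in *. field; auto.
Qed.
End Pointwise.
End Spacetime.

(** * Conservation laws *)

Lemma interval_constant (lo hi : Rbar) (f : R -> R) :
  Rbar_interval lo hi 0 ->
  (forall l, Rbar_interval lo hi l -> is_derive f l 0) ->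
  forall l, Rbar_interval lo hi l -> f l = f 0.
Proof.
intros [h1 h2] Hf l [h3 h4].
assert (between : forall x y s, Rbar_lt lo (Finite x) -> Rbar_lt (Finite y) hi ->
  x <= s <= y -> Rbar_interval lo hi s).
{ intros x y s hx hy [h5 h6]. split.
  - apply Rbar_lt_le_trans with x; auto.
  - apply Rbar_le_lt_trans with y; auto. }
destruct (Rtotal_order l 0) as [hl|[->|hl]]; auto.
- apply (eq_is_derive f l 0); auto. intros s hs. apply Hf.
  now apply (between l 0).
- symmetry. apply (eq_is_derive f 0 l); auto. intros s hs. apply Hf.
  now apply (between 0 l).
Qed.

Section Trajectory.
Variables (k : KNdS) (e : R) (gamma : R -> point) (lo hi : Rbar).
Hypothesis chi_neq0 : chi k <> 0.
Hypothesis interval0 : Rbar_interval lo hi 0.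
Hypothesis reg : forall l, Rbar_interval lo hi l -> regular k (gamma l).
Hypothesis traj : trajectory k e (Rbar_interval lo hi) gamma.

Lemma is_derive_momentum l n : Rbar_interval lo hi l ->
  is_derive (fun s => momentum k e gamma s n) l
    (partial n (fun y => lagrangian k e (y cr) (y cth) (velocity gamma l)) (gamma l)).
Proof.
intros Il. destruct (traj l Il) as [hex heq].
replace (partial _ _ _) with (partial n (fun y =>
  / 2 * qform (metric k y) (velocity gamma l)
  + e * sumc (fun i => potential k y i * velocity gamma l i)) (gamma l)).
2:{ apply Derive_ext. intros s. apply lagrangianE. }
apply euler_lagrange; auto.
- apply inverse_metric_spec; auto.
- intros i j. apply chain_at_metric; auto. apply hex.
- intros i. apply chain_at_potential; auto. apply hex.
- apply hex.
Qed.

Lemma is_derive_momentum_cr l : Rbar_interval lo hi l ->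
  is_derive (fun s => momentum k e gamma s cr) l
    (lagrangian_dr k e (gamma l cr) (gamma l cth) (velocity gamma l)).
Proof.
intros Il. destruct (regular_neq0 k _ (reg l Il)) as (S0 & R0 & T0 & _).
rewrite <- (is_derive_unique _ _ _ (is_derive_lagrangian_r k e chi_neq0 _ _ _ S0 R0 T0)).
apply (is_derive_momentum l cr Il).
Qed.

Lemma is_derive_momentum_cth l : Rbar_interval lo hi l ->
  is_derive (fun s => momentum k e gamma s cth) l
    (lagrangian_dtheta k e (gamma l cr) (gamma l cth) (velocity gamma l)).
Proof.
intros Il. destruct (regular_neq0 k _ (reg l Il)) as (S0 & R0 & T0 & _).
rewrite <- (is_derive_unique _ _ _ (is_derive_lagrangian_theta k e chi_neq0 _ _ _ S0 R0 T0)).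
apply (is_derive_momentum l cth Il).
Qed.

Lemma energy_constant l : Rbar_interval lo hi l ->
  energy_at k e gamma l = energy_at k e gamma 0.
Proof.
apply interval_constant; auto. clear l. intros l Il.
rewrite <- Ropp_0. apply (is_derive_opp (V := R_NormedModule)).
(* Changing t leaves r and theta alone, so the partial derivative is by conversion that of a
   constant function. *)
rewrite <- (Derive_const (lagrangian k e (gamma l cr) (gamma l cth) (velocity gamma l))
  (gamma l ct)).
apply (is_derive_momentum l ct Il).
Qed.

Lemma angmom_constant l : Rbar_interval lo hi l ->
  angmom_at k e gamma l = angmom_at k e gamma 0.
Proof.
apply interval_constant; auto. clear l. intros l Il.
rewrite <- (Derive_const (lagrangian k e (gamma l cr) (gamma l cth) (velocity gamma l))
  (gamma l cph)).
apply (is_derive_momentum l cph Il).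
Qed.

Lemma mu_constant l : Rbar_interval lo hi l ->
  mu_at k e gamma l = mu_at k e gamma 0.
Proof.
intros Il. rewrite !mu_atE; auto.
revert l Il.
apply (interval_constant lo hi
  (fun s => qform (metric k (gamma s)) (velocity gamma s))); auto.
intros l Il. destruct (traj l Il) as [hex heq].
apply (is_derive_qform_velocity (metric k) (potential k) e); auto.
- apply metric_sym.
- apply inverse_metric_spec; auto.
- intros i j. apply chain_at_metric; auto. apply hex.
- apply hex.
Qed.

(** Once E, L and mu are fixed, only theta and p_theta vary. Substituting Sigma theta' = Delta_theta
    p_theta and the separated equation for p_theta' cancels every term of the derivative. *)
Lemma carter_constant l : Rbar_interval lo hi l ->
  carter_at k e gamma l = carter_at k e gamma 0.
Proof.
set (E := energy_at k e gamma 0). set (L := angmom_at k e gamma 0).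
set (mu := mu_at k e gamma 0).
(* [K] is the Carter expression with E, L and mu frozen at parameter 0; it agrees with [carter_at]
   on the interval. *)
set (K := fun s => Delta_theta k (gamma s cth) * momentum k e gamma s cth ^ 2
  + W_theta k E L (gamma s cth) ^ 2 / Delta_theta k (gamma s cth)
  - mu * spin k ^ 2 * cos (gamma s cth) ^ 2).
assert (HK : forall s, Rbar_interval lo hi s -> carter_at k e gamma s = K s).
{ intros s Is. unfold carter_at, K.
  now rewrite energy_constant, angmom_constant, mu_constant. }
intros Il. rewrite !HK; auto. revert l Il.
apply interval_constant; auto. intros l Il.
assert (HKl := HK l Il).
destruct (regular_neq0 k _ (reg l Il)) as (S0 & R0 & T0 & s0).
assert (HS := lagrangian_dtheta_separated k e chi_neq0 gamma l (reg l Il)).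
rewrite energy_constant, angmom_constant, mu_constant, HKl in HS; auto.
fold E L mu in HS.
assert (HP := is_derive_momentum_cth l Il).
assert (Hp := momentum_cth k e gamma l).
assert (HT : is_derive (fun s => gamma s cth) l (velocity gamma l cth)).
{ apply Derive_correct. exact (proj1 (proj1 (traj l Il) cth)). }
assert (HD := Derive_correct _ _ (ex_derive_Delta_theta k (gamma l cth))).
assert (HW : is_derive (fun th => W_theta k E L th ^ 2) (gamma l cth)
  (Derive (fun th => W_theta k E L th ^ 2) (gamma l cth))).
{ apply Derive_correct. unfold W_theta. auto_derive. easy. }
unfold K in HS |- *. clear K HK HKl.
(* Naming these functions keeps them opaque to [auto_derive], so that only their known derivatives
   enter. *)
set (W2 := fun th => W_theta k E L th ^ 2) in *.
set (p := fun s => momentum k e gamma s cth) in *.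
set (th := fun s => gamma s cth) in *.
change (is_derive (fun s => Delta_theta k (th s) * p s ^ 2
  + W2 (th s) / Delta_theta k (th s) - mu * spin k ^ 2 * cos (th s) ^ 2) l 0).
change (momentum k e gamma l cth) with (p l) in *.
change (W_theta k E L (gamma l cth) ^ 2) with (W2 (th l)) in *.
change (gamma l cth) with (th l) in *.
set (P' := lagrangian_dtheta _ _ _ _ _) in *. clearbody P'.
set (D' := Derive (Delta_theta k) (th l)) in *.
set (W' := Derive W2 (th l)) in *.
auto_derive.
- repeat split; auto; eexists; eassumption.
- replace (Derive (fun x => th x) l) with (velocity gamma l cth)
    by (symmetry; now apply is_derive_unique).
  replace (Derive (fun x => p x) l) with P' by (symmetry; now apply is_derive_unique).
  change (Derive (fun x => Delta_theta k x) (th l)) with D'.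
  change (Derive (fun x => W2 x) (th l)) with W'.
  set (S := Sigma k (gamma l cr) (th l)) in *.
  replace (velocity gamma l cth) with (Delta_theta k (th l) * p l / S)
    by (rewrite Hp; field; auto).
  replace P' with (S * P' / S) by (field; auto).
  rewrite HS. field; auto.
Qed.
End Trajectory.

(** * The first order system *)

Theorem corollary3p1p2
  (k : KNdS) (hM : 0 <= mass k) (hQ : 0 <= charge k) (hJ : 0 <= angmom k)
  (hchi : chi k <> 0)
  (e : R) (lo hi : Rbar) (hI : Rbar_interval lo hi 0)
  (t r theta phi : R -> R) (mu E L kappa : R)
  (hreg : forall l, Rbar_interval lo hi l -> regular k (curve t r theta phi l))
  (htraj : trajectory k e (Rbar_interval lo hi) (curve t r theta phi))
  (hcausal : timelike k (Rbar_interval lo hi) (curve t r theta phi) \/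
             lightlike k (Rbar_interval lo hi) (curve t r theta phi))
  (hconst : constants_of_motion k e (curve t r theta phi) mu E L kappa) :
  let a := spin k in
  let p_r := fun l => momentum k e (curve t r theta phi) l cr in
  let p_theta := fun l => momentum k e (curve t r theta phi) l cth in
  forall l, Rbar_interval lo hi l ->
    let Sg := Sigma k (r l) (theta l) in
    let Dr := Delta_r k (r l) in
    let Dr' := Derive (Delta_r k) (r l) in
    let Dth := Delta_theta k (theta l) in
    let Dth' := Derive (Delta_theta k) (theta l) in
    let Wr := W_r k e E L (r l) in
    let Wth := W_theta k E L (theta l) in
    let dWr2 := Derive (fun x => W_r k e E L x ^ 2) (r l) in
    let dWth2 := Derive (fun x => W_theta k E L x ^ 2) (theta l) in
    (ex_derive t l /\
     Sg / chi k * Derive t l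
     = Wr * (r l ^ 2 + a ^ 2) / Dr - a * Wth * sin (theta l) / Dth) /\
    (ex_derive r l /\
     Sg * Derive r l = Dr * p_r l) /\
    (ex_derive p_r l /\
     Sg * Derive p_r l
     = (dWr2 - Dr' * (kappa - mu * r l ^ 2)) / (2 * Dr)
       + mu * r l - Dr' * p_r l ^ 2) /\
    (ex_derive theta l /\
     Sg * Derive theta l = Dth * p_theta l) /\
    (ex_derive p_theta l /\
     Sg * Derive p_theta l
     = (- dWth2 + Dth' * (kappa + mu * a ^ 2 * cos (theta l) ^ 2)) / (2 * Dth)
       - mu * a ^ 2 * cos (theta l) * sin (theta l) - Dth' * p_theta l ^ 2) /\
    (ex_derive phi l /\
     Sg / chi k * Derive phi l
     = a * Wr / Dr - Wth / (Dth * sin (theta l))).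

Proof.
set (gamma := curve t r theta phi) in *.
destruct hconst as (-> & -> & -> & ->).
cbv zeta. intros l Il.
(* Conservation moves the constants from parameter 0 to [l], where the pointwise identities
   apply. *)
rewrite <- (energy_constant k e gamma lo hi hchi hI hreg htraj l Il),
  <- (angmom_constant k e gamma lo hi hchi hI hreg htraj l Il),
  <- (mu_constant k e gamma lo hi hchi hI hreg htraj l Il),
  <- (carter_constant k e gamma lo hi hchi hI hreg htraj l Il).
assert (hl := hreg l Il).
destruct (regular_neq0 k _ hl) as (S0 & R0 & T0 & s0).
assert (hex := fun i => proj1 (proj1 (htraj l Il) i)).
assert (Hr := is_derive_momentum_cr k e gamma lo hi hchi hreg htraj l Il).
assert (Hth := is_derive_momentum_cth k e gamma lo hi hchi hreg htraj l Il).
change (r l) with (gamma l cr). change (theta l) with (gamma l cth).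
repeat split.
- exact (hex ct).
- change (Derive t l) with (velocity gamma l ct).
  rewrite W_rE, W_thetaE; auto.
  transitivity (Sigma k (gamma l cr) (gamma l cth) * velocity gamma l ct / chi k).
  { field; auto. }
  rewrite velocity_ct. field; auto.
- exact (hex cr).
- rewrite momentum_cr. change (Derive r l) with (velocity gamma l cr). field; auto.
- eexists; exact Hr.
- etransitivity; [apply (f_equal (Rmult _) (is_derive_unique _ _ _ Hr))|].
  now apply lagrangian_dr_separated.
- exact (hex cth).
- rewrite momentum_cth. change (Derive theta l) with (velocity gamma l cth). field; auto.
- eexists; exact Hth.
- etransitivity; [apply (f_equal (Rmult _) (is_derive_unique _ _ _ Hth))|].
  now apply lagrangian_dtheta_separated.
- exact (hex cph).
- change (Derive phi l) with (velocity gamma l cph).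
  rewrite W_rE, W_thetaE; auto.
  transitivity (Sigma k (gamma l cr) (gamma l cth) * velocity gamma l cph / chi k).
  { field; auto. }
  rewrite velocity_cph. field; auto.
Qed.
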